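(* Let $p\in\{13,29\}$. Then for every Dehn $p$-colorable knot $K$, \[ \mathrm{mincol}_p(K)\ \ge\ \lfloor \log_2 p\rfloor+3 . \] (That is, $\mathrm{mincol}_{13}(K)\ge 6$ and $\mathrm{mincol}_{29}(K)\ge 7$ for all Dehn $13$-, resp. $29$-colorable knots $K$.)
   Context: Let $p$ be an odd prime and $\mathbb Z_p=\mathbb Z/p\mathbb Z$. Let $D$ be a diagram of a knot and $\mathcal R(D)$ its set of regions. At a crossing, label the four surrounding regions $x_1,x_2,x_3,x_4$ so that $x_2$ is adjacent to $x_1$ across an under-arc, $x_3$ is adjacent to $x_1$ across the over-arc, and $x_4$ is the region opposite to $x_1$. A Dehn $p$-coloring of $D$ is a map $C:\mathcal R(D)\to\mathbb Z_p$ such that at every crossing $C(x_1)+C(x_3)=C(x_2)+C(x_4)$ (this condition does not depend on which of the four regions is chosen as $x_1$). A crossing is trivially colored by $C$ if $C(x_1)=C(x_4)$ and $C(x_2)=C(x_3)$; $C$ is trivial if every crossing is trivially colored (equivalently, $C$ is constant or a checkerboard coloring), and nontrivial otherwise. A knot $K$ is Dehn $p$-colorable if some diagram of $K$ admits a nontrivial Dehn $p$-coloring. For such $K$, $\mathrm{mincol}_p(K)$ denotes the minimum, over all diagrams $D$ of $K$ and all nontrivial Dehn $p$-colorings $C$ of $D$, of the number $\#C(\mathcal R(D))$ of distinct colors used. *)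

(* Defs.v *)
From HB Require Import structures.
From mathcomp Require Import all_boot all_algebra.
Set Implicit Arguments. Unset Strict Implicit. Unset Printing Implicit Defensive.
Import GRing.Theory.

(* A diagram with n crossings.  Its darts (half-edges) are pairs (v, i):
   crossing v : 'I_n, position i : 'I_4 in counterclockwise order around v.
   Darts (v,0),(v,2) form the over-arc at v, darts (v,1),(v,3) the under-arc
   (any diagram can be labelled so; this is a labelling convention). *)
Notation dart n := ('I_n * 'I_4)%type.

Definition rot n (d : dart n) : dart n := (d.1, ordS d.2).

(* alpha : the edge involution pairing the two ends of each edge.
   face_perm = sigma o alpha; its orbits are the faces (= regions).
   The corner between darts e and rot e lies in the face of rot e. *)
Definition face_perm n (alpha : dart n -> dart n) (d : dart n) : dart n :=
  rot (alpha d).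

(* strand_perm = sigma^2 o alpha: go along an edge and straight through the
   next crossing; its orbits are the directed traversals of the components,
   so a one-component diagram (knot) has exactly 2 orbits. *)
Definition strand_perm n (alpha : dart n -> dart n) (d : dart n) : dart n :=
  rot (rot (alpha d)).

(* A knot diagram: a connected 4-valent map of genus 0 (Euler: V - E + F = 2,
   i.e. #faces = n + 2 since E = 2n) with a single component. *)
Definition is_knot_diagram n (alpha : dart n -> dart n) : Prop :=
  [/\ (0 < n)%N, involutive alpha, (forall d, alpha d != d),
      fcard (strand_perm alpha) predT = 2%N &
      fcard (face_perm alpha) predT = (n + 2)%N].

(* dart representing the region at corner k (k = 0..3) of crossing v,
   corner k being between darts (v,k) and (v,k+1). *)
Definition cdart n (v : 'I_n) (k : nat) : dart n := (v, ordS (inord k)).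

(* A Dehn p-coloring: a map on regions, represented as a map on darts that is
   constant on faces.  At crossing v: x1 = corner 0, x2 = corner 1 (across the
   under-arc dart 1), x3 = corner 3 (across the over-arc dart 0), x4 = corner 2. *)
Definition dehn_coloring (p n : nat) (alpha : dart n -> dart n)
    (C : dart n -> 'Z_p) : Prop :=
  (forall d, C (face_perm alpha d) = C d) /\
  (forall v : 'I_n,
     (C (cdart v 0) + C (cdart v 3) = C (cdart v 1) + C (cdart v 2))%R).

Definition trivially_colored (p n : nat) (C : dart n -> 'Z_p) (v : 'I_n) : Prop :=
  C (cdart v 0) = C (cdart v 2) /\ C (cdart v 1) = C (cdart v 3).

Definition nontrivial_coloring (p n : nat) (C : dart n -> 'Z_p) : Prop :=
  exists v : 'I_n, ~ trivially_colored C v.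

(* number of distinct colors used, #C(R(D)) (every region contains a dart) *)
Definition num_colors (p n : nat) (C : dart n -> 'Z_p) : nat :=
  #|[set C d | d : dart n]|.

(* Main.v *)
From Stdlib Require Import BinNat.
From mathcomp Require Import all_boot all_algebra zify ring.
Require Import Defs.
Set Implicit Arguments. Unset Strict Implicit. Unset Printing Implicit Defensive.
Import GRing.Theory.

(** Label each edge of the diagram by the unordered pair of colors on its two
    sides. A crossing with over-edges [{l, r}], [{l', r'}] and under-edges
    [{l, l'}], [{r, r'}] satisfies [l + r = l' + r'], and the knot runs straight
    through it from [{l, r}] to [{l', r'}] and from [{l, l'}] to [{r, r'}]. Since
    the knot has one component, all the labels that occur are connected by such
    steps, using only crossings all of whose labels occur. After an affine
    change of colors the palette contains 0 and 1, and a finite computation over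
    all palettes with at most 5 (p = 13) or 6 (p = 29) colors shows that
    discarding alternately the crossings and the labels outside one component
    eliminates every crossing whose relation is not an identity. A coloring
    without such crossings is trivial, since diagonal labels [{x, x}] are then
    connected only to diagonal labels. *)

(** * Connectivity of a knot along its strand *)

Section StrandConnectivity.

Variables (n : nat) (alpha : dart n -> dart n).
Hypothesis knot_alpha : is_knot_diagram alpha.

Let alphaK : involutive alpha. Proof. by case: knot_alpha. Qed.

Lemma iter4_rot (d : dart n) : rot (rot (rot (rot d))) = d.
Proof. by case: d => v [[|[|[|[]]]] //= i]; congr pair; apply: val_inj. Qed.

Lemma rot_inj : injective (@rot n).
Proof. exact: (can_inj (g := fun d => rot (rot (rot d))) iter4_rot). Qed.

Lemma rot2_neq (d : dart n) : rot (rot d) <> d.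
Proof. by case: d => v [[|[|[|[]]]] //= i] []. Qed.

Lemma strand_perm_inj : injective (strand_perm alpha).
Proof. by move=> d e /rot_inj /rot_inj /(inv_inj alphaK). Qed.

(* [alpha] conjugates the strand permutation to its inverse, so halving [k]
   would produce a fixed point of [alpha] or of [rot \o rot]. *)
Lemma iter_strand_perm_neq_alpha k (d : dart n) :
  alpha d <> iter k (strand_perm alpha) d.
Proof.
have [_ _ alpha_neq _ _] := knot_alpha.
elim/ltn_ind: k d => -[|[|k]] IH d /=.
- by apply/eqP/alpha_neq.
- by move=> /esym /rot2_neq.
move=> e; apply: (IH k (leqnSn _) (strand_perm alpha d)).
by apply: strand_perm_inj; rewrite -iterSr /= -e /strand_perm alphaK iter4_rot.
Qed.

(** [d] and [alpha d] lie in different orbits, and there are only two orbits, so every dart is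
    reached from one of them. *)
Lemma strand_perm_transitive (d e : dart n) :
  fconnect (strand_perm alpha) d e \/ fconnect (strand_perm alpha) (alpha d) e.
Proof.
have [_ _ _ card2 _] := knot_alpha.
have symc := fconnect_sym strand_perm_inj.
apply/orP; apply: contraTT isT => /norP[nde nade].
pose s := [:: froot (strand_perm alpha) d; froot (strand_perm alpha) (alpha d);
  froot (strand_perm alpha) e].
have us : uniq s.
  rewrite /= !inE !(root_connect symc) (negPf nde) (negPf nade) orbF !andbT.
  apply/negP => /iter_findex /esym; exact: iter_strand_perm_neq_alpha.
have: size s <= fcard (strand_perm alpha) predT.
  rewrite -(card_uniqP us) /n_comp_mem; apply/subset_leq_card/subsetP => x.
  by rewrite !inE => /or3P[] /eqP ->; rewrite (roots_root symc).
by rewrite card2.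
Qed.

Lemma strand_invariant_const (T : eqType) (g : dart n -> T) :
  (forall d, g (alpha d) = g d) -> (forall d, g (rot (rot d)) = g d) ->
  forall d e, g d = g e.
Proof.
move=> g_alpha g_rot2.
have g_conn d e : fconnect (strand_perm alpha) d e -> g d = g e.
  move=> /iter_findex <-; elim: (findex _ _ _) => //= k ->.
  by rewrite /strand_perm g_rot2 g_alpha.
by move=> d e; have [/g_conn//|/g_conn <-] := strand_perm_transitive d e.
Qed.

End StrandConnectivity.

(** * Edge labels and essential crossings *)

Section Coloring.

Variables (p n : nat) (alpha : dart n -> dart n) (C : dart n -> 'Z_p).
Hypotheses (knot_alpha : is_knot_diagram alpha) (dehnC : dehn_coloring alpha C).

(* [corner v k] is the color of the region clockwise of dart [(v, k)], so the
   edge at [(v, k)] separates [corner v k] from [corner v (k + 1)]. *)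
Definition corner (v : 'I_n) (k : nat) : 'Z_p := C (v, inord k).

Lemma cdart_corner v k : k < 4 -> C (cdart v k) = corner v (k.+1 %% 4).
Proof.
by move=> k4; congr (C (_, _)); apply/val_inj; rewrite /= !inordK ?ltn_mod.
Qed.

Lemma corner_eq v : (corner v 0 + corner v 1 = corner v 2 + corner v 3)%R.
Proof.
by rewrite addrC; have := dehnC.2 v; rewrite !cdart_corner.
Qed.

Lemma trivially_coloredP v :
  trivially_colored C v <-> corner v 0 = corner v 2 /\ corner v 1 = corner v 3.
Proof.
by rewrite /trivially_colored !cdart_corner //; split=> -[].
Qed.

(** A symmetric [h] depends only on the edge, as its two darts see the same two colors in opposite
    order. The other hypotheses carry the value straight through each crossing. *)
Lemma edge_invariant_const (h : 'Z_p -> 'Z_p -> bool) :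
  (forall x y, h x y = h y x) ->
  (forall v, h (corner v 0) (corner v 1) = h (corner v 2) (corner v 3)) ->
  (forall v, h (corner v 1) (corner v 2) = h (corner v 3) (corner v 0)) ->
  exists b, forall v, [/\ h (corner v 0) (corner v 1) = b,
    h (corner v 1) (corner v 2) = b, h (corner v 2) (corner v 3) = b &
    h (corner v 3) (corner v 0) = b].
Proof.
move=> hC h_over h_under; have [n_gt0 alphaK _ _ _] := knot_alpha.
pose g d := h (C d) (C (rot d)).
have gE v k : k < 4 -> g (v, inord k) = h (corner v k) (corner v (k.+1 %% 4)).
  move=> k4; rewrite /g /corner; congr (h _ (C (_, _))).
  by apply/val_inj; rewrite /= !inordK ?ltn_mod.
(* Constancy on faces, used at [d] and at [alpha d], shows that [alpha] swaps the two colors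
   seen. *)
have g_alpha d : g (alpha d) = g d.
  rewrite /g hC -[X in _ = h _ (C (rot X))]alphaK.
  by have := dehnC.1 d; have := dehnC.1 (alpha d); rewrite /face_perm => -> ->.
have g_rot2 d : g (rot (rot d)) = g d.
  have rotE v k : k < 4 -> rot (v, inord k) = (v, inord (k.+1 %% 4)) :> dart n.
    by move=> k4; congr pair; apply/val_inj; rewrite /= !inordK ?ltn_mod.
  case: d => v i; rewrite -[i]inord_val !rotE ?ltn_mod //.
  rewrite !gE ?ltn_mod //; case: i => -[|[|[|[]]]] //= _.
have gconst := strand_invariant_const knot_alpha g_alpha g_rot2.
pose d0 : dart n := (Ordinal n_gt0, inord 0).
have gd0 v k : k < 4 -> h (corner v k) (corner v (k.+1 %% 4)) = g d0.
  by move=> k4; rewrite -gE // (gconst _ d0).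
by exists (g d0) => v; split; [apply: (gd0 v 0) | apply: (gd0 v 1)
  | apply: (gd0 v 2) | apply: (gd0 v 3)].
Qed.

(* The crossings whose relation between the four colors is not an identity. *)
Definition essential v := (corner v 0 != corner v 2) && (corner v 0 != corner v 3).

Lemma not_essential v : ~~ essential v ->
  (corner v 0 = corner v 2 /\ corner v 1 = corner v 3) \/
  (corner v 0 = corner v 3 /\ corner v 1 = corner v 2).
Proof.
have := corner_eq v; rewrite /essential negb_and !negbK => eqv /orP[]/eqP e0.
  by left; split=> //; move: eqv; rewrite e0 => /addrI.
by right; split=> //; move: eqv; rewrite e0 addrC => /addIr.
Qed.

(** If no crossing is essential, being diagonal is constant along the knot. A crossing with
    [corner v 0 = corner v 3] has diagonal under-edges, hence diagonal over-edges, so it is trivial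
    too. *)
Lemma nontrivial_essential : nontrivial_coloring C -> exists v, essential v.
Proof.
move=> [v0 ntv]; apply/existsP; apply: contraT; rewrite negb_exists => /forallP ness.
have [||| b hb] := @edge_invariant_const (fun x y => x == y); first exact: eq_sym.
- by move=> v; case: (not_essential (ness v)) => -[-> ->] //; rewrite eq_sym.
- by move=> v; case: (not_essential (ness v)) => -[-> ->] //; rewrite !eqxx.
case: ntv; apply/trivially_coloredP.
case: (not_essential (ness v0)) => // -[e0 e1].
move: (hb v0); rewrite -e1 -e0 eqxx => -[e01 eb _ _].
by move: e01; rewrite -eb => /eqP ->.
Qed.

End Coloring.

(** * The finite computation on keys and palettes *)

Definition memN (x : N) (A : seq N) : bool := has (N.eqb x) A.

(* Diagonal pairs share one key: the two under-edges of a crossing colored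
   [x, x | y, y] are diagonal. Soundness uses only the symmetry of [key], so
   an accidental collision of keys would be harmless. *)
Definition key (a b : N) : N := if N.eqb a b then 0%num else (32 * (a * b) + (a + b))%num.

(* The keys of the two over-edges and of the two under-edges of a crossing. *)
Definition crossing_keys := ((N * N) * (N * N))%type.

Definition grow_edge (A : seq N) (e : N * N) : seq N :=
  if memN e.1 A then (if memN e.2 A then A else e.2 :: A)
  else if memN e.2 A then e.1 :: A else A.

(* Five passes suffice here; [refute] rechecks that the result is closed. *)
Definition component (Q : seq crossing_keys) (a : N) : seq N :=
  let E := flatten [seq [:: q.1; q.2] | q <- Q] in
  iter 5 (fun A => foldl grow_edge A E) [:: a].

Definition closed_at (A : seq N) (q : crossing_keys) : bool :=
  (memN q.1.1 A == memN q.1.2 A) && (memN q.2.1 A == memN q.2.2 A).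

Definition inside (b : bool) (A : seq N) (q : crossing_keys) : bool :=
  (memN q.1.1 A == b) && (memN q.2.1 A == b).

(* All edges of the knot lie in one component of the graph that the crossings
   in [Q] induce on keys; restrict [Q] to each side and iterate. *)
Fixpoint refute (m : nat) (Q : seq crossing_keys) : bool :=
  match m, Q with
  | _, [::] => true
  | m'.+1, q :: _ =>
    let A := component Q q.1.1 in
    if all (closed_at A) Q then
      if refute m' (filter (inside true A) Q) then
        refute m' (filter (inside false A) Q)
      else false
    else false
  | _, _ => false
  end.

(** One subtraction suffices for a sum of two residues. *)
Definition reduce (p s : N) : N := if (s <? p)%num then s else (s - p)%num.

Fixpoint pair_sums (p : N) (S : seq N) : seq (N * (N * N)) :=
  if S is a :: S' then
    [seq (reduce p (a + b)%num, (a, b)) | b <- S] ++ pair_sums p S'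
  else [::].

(** Two over-edges with equal sums can meet in two ways: [a] shares its side of the over-arc with
    [c] or with [d]. *)
Definition add_crossings (x y : N * (N * N)) (Q : seq crossing_keys) :=
  if N.eqb x.1 y.1 then
    let: (a, b) := x.2 in let: (c, d) := y.2 in
    [:: ((key a b, key c d), (key a c, key b d)),
        ((key a b, key c d), (key a d, key b c)) & Q]
  else Q.

Fixpoint all_crossings (P : seq (N * (N * N))) : seq crossing_keys :=
  if P is x :: P' then foldr (add_crossings x) (all_crossings P') P' else [::].

Definition refute_palette (p : N) (S : seq N) : bool :=
  let Q := all_crossings (pair_sums p S) in refute (size Q) Q.

(** Each candidate is left out or added; [m] bounds the number of additions. *)
Fixpoint refute_palettes (p : N) (cands : seq N) (m : nat) (S : seq N) : bool :=
  match cands, m with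
  | c :: cands', m'.+1 =>
    if refute_palettes p cands' m S then refute_palettes p cands' m' (c :: S)
    else false
  | _, _ => refute_palette p S
  end.

Definition refute_small_palettes (p k : nat) : bool :=
  refute_palettes (N.of_nat p) [seq N.of_nat i | i <- iota 2 (p - 2)] (k - 2)
    [:: 1%num; 0%num].

(** * Completeness of the enumeration of crossings *)

Lemma keyC a b : key a b = key b a.
Proof. by rewrite /key N.eqb_sym; case: ifP => // _; congr N.add; lia. Qed.

Lemma keyxx a : key a a = 0%num.
Proof. by rewrite /key N.eqb_refl. Qed.

Definition same_pair (T : Type) (x : T * T) (a b : T) := x = (a, b) \/ x = (b, a).

Lemma pair_sums_mem p S a b : a \in S -> b \in S ->
  exists2 x, same_pair x a b & (reduce p (a + b)%num, x) \in pair_sums p S.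
Proof.
elim: S => // c S IH; rewrite [a \in _]inE [b \in _]inE /= => aS bS.
have head d : d \in c :: S ->
    (reduce p (c + d)%num, (c, d)) \in pair_sums p (c :: S).
  move=> dS; rewrite -/([seq (reduce p (c + b)%num, (c, b)) | b <- c :: S] ++ _).
  by rewrite mem_cat map_f.
case/orP: aS bS => [/eqP -> | aS].
  by move=> bS; exists (c, b); [left | apply: head; rewrite inE].
case/orP => [/eqP -> | bS].
  exists (c, a); first by right.
  by rewrite N.add_comm; apply: head; rewrite inE aS orbT.
have [x xab xS] := IH aS bS; exists x => //.
by rewrite inE mem_cat xS !orbT.
Qed.

Lemma mem_add_crossings x y Q q : q \in Q -> q \in add_crossings x y Q.
Proof.
move=> qQ; rewrite /add_crossings; case: ifP => // _.
by case: x.2 y.2 => a b [c d]; rewrite !inE qQ !orbT.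
Qed.

Lemma foldr_add_crossings x P Q y : y \in P ->
  {subset add_crossings x y [::] <= foldr (add_crossings x) Q P}.
Proof.
elim: P => //= z P IH; rewrite inE => /orP[/eqP <- | /IH sub] q qxy; last first.
  by apply: mem_add_crossings; apply: sub.
move: qxy; rewrite /add_crossings; case: ifP => // _.
by case: x.2 y.2 => a b [c d]; rewrite !inE => /orP[]->; rewrite ?orbT.
Qed.

Lemma all_crossings_mem P x y : x \in P -> y \in P -> x != y ->
  {subset add_crossings x y [::] <= all_crossings P} \/
  {subset add_crossings y x [::] <= all_crossings P}.
Proof.
elim: P => //= z P IH; rewrite !inE => /orP[/eqP->|xP] /orP[/eqP->|yP] xy.
- by rewrite eqxx in xy.
- by left; apply: foldr_add_crossings.
- by right; apply: foldr_add_crossings.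
have mono Q : {subset Q <= foldr (add_crossings z) Q P}.
  by elim: P {IH xP yP} => //= u P IH q /IH; apply: mem_add_crossings.
by case: (IH xP yP xy) => sub; [left | right] => q /sub /mono.
Qed.

Definition keys_of (q : crossing_keys) (l r l' r' : N) :=
  same_pair q.1 (key l r) (key l' r') /\ same_pair q.2 (key l l') (key r r').

Lemma add_crossings_keys x y l r l' r' : x.1 = y.1 ->
  same_pair x.2 l r -> same_pair y.2 l' r' ->
  exists2 q, q \in add_crossings x y [::] & keys_of q l r l' r'.
Proof.
move=> exy xE yE; rewrite /add_crossings exy N.eqb_refl.
have fst_mem (q1 q2 : crossing_keys) : q1 \in [:: q1; q2] by exact: mem_head.
have snd_mem (q1 q2 : crossing_keys) : q2 \in [:: q1; q2] by rewrite !inE eqxx orbT.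
case: xE => ->; case: yE => ->;
  [eexists; first exact: fst_mem | eexists; first exact: snd_mem
  | eexists; first exact: snd_mem | eexists; first exact: fst_mem];
  split => /=; rewrite ?(keyC r l) ?(keyC r' l'); by [left | right].
Qed.

Lemma keys_ofC q l r l' r' : keys_of q l r l' r' -> keys_of q l' r' l r.
Proof.
by rewrite /keys_of (keyC l' l) (keyC r' r) => -[[->|->] uE]; split=> //; by [left | right].
Qed.

(** [all_crossings] never combines an entry with itself; [l <> l'] and [l <> r'] ensure that the two
    over-edges come from different entries. *)
Lemma all_crossings_keys p S l r l' r' :
  l \in S -> r \in S -> l' \in S -> r' \in S ->
  reduce p (l + r)%num = reduce p (l' + r')%num -> l <> l' -> l <> r' ->
  exists2 q, q \in all_crossings (pair_sums p S) & keys_of q l r l' r'.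
Proof.
move=> lS rS l'S r'S eqs ll' lr'.
have [x xE xS] := pair_sums_mem p lS rS.
have [y yE yS] := pair_sums_mem p l'S r'S.
have xy : (reduce p (l + r)%num, x) != (reduce p (l' + r')%num, y).
  apply/eqP => -[_ exy]; move: xE yE; rewrite exy.
  by move=> [->|->] [] [] => *; subst.
have [] := all_crossings_mem xS yS xy => sub.
  have [q /sub qQ qE] := add_crossings_keys (x := (_, x)) (y := (_, y)) eqs xE yE.
  by exists q.
have [q /sub qQ qE] :=
  add_crossings_keys (x := (_, y)) (y := (_, x)) (esym eqs) yE xE.
by exists q; last exact: keys_ofC.
Qed.

(** * Soundness of the refutation of one palette *)

Section RefuteSound.

Variables (p n : nat) (alpha : dart n -> dart n) (C : dart n -> 'Z_p).
Hypotheses (knot_alpha : is_knot_diagram alpha) (dehnC : dehn_coloring alpha C).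

Definition color_code (x : 'Z_p) : N := N.of_nat x.

Let code v k := color_code (corner C v k).

(** Membership in the closed set [A] is constant over all edges, so all essential crossings survive
    in the same one of the two filtered lists; an empty list leaves none. *)
Lemma refute_sound m Q : refute m Q ->
  (forall v, essential C v ->
     exists2 q, q \in Q & keys_of q (code v 0) (code v 1) (code v 3) (code v 2)) ->
  forall v, ~~ essential C v.
Proof.
elim: m Q => [|m IH] [|q0 Q0] //; try by move=> _ cov v; apply/negP => /cov[].
set Q := q0 :: Q0; pose A := component Q q0.1.1.
rewrite -[refute _ _]/(if all (closed_at A) Q then
  if refute m (filter (inside true A) Q) then
    refute m (filter (inside false A) Q) else false else false).
case: ifP => // clA; case: ifP => // refT refF cov.
pose h x y := memN (key (color_code x) (color_code y)) A.
have hC x y : h x y = h y x by rewrite /h keyC.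
have h_ess v : essential C v ->
    h (corner C v 0) (corner C v 1) = h (corner C v 2) (corner C v 3) /\
    h (corner C v 1) (corner C v 2) = h (corner C v 3) (corner C v 0).
  move=> /cov[q qQ [oE uE]]; have := allP clA _ qQ; rewrite /closed_at.
  rewrite hC (hC (corner C v 2)) (hC (corner C v 3) (corner C v 0)) /h -!/(code v _).
  rewrite (keyC (code v 1) (code v 0)).
  by case: oE => ->; case: uE => -> /= /andP[/eqP -> /eqP ->].
(* At a crossing that is not essential, opposite edges have equal labels, or the under-edges are
   diagonal and share the key 0. *)
have [//||| b hb] := edge_invariant_const knot_alpha dehnC (h := h).
- move=> v; have [/h_ess[]//|/(not_essential dehnC)] := boolP (essential C v).
  by case=> -[-> ->].
- move=> v; have [/h_ess[]//|/(not_essential dehnC)] := boolP (essential C v).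
  by case=> -[-> ->] //; rewrite /h !keyxx.
have refb : refute m (filter (inside b A) Q) by case: b {hb}.
apply: (IH _ refb) => v /cov[q qQ qE]; exists q => //.
rewrite mem_filter qQ andbT /inside; have [h01 h12 h23 h30] := hb v.
move: h01 h12 h23 h30 qE; rewrite /h -!/(code v _) => h01 h12 h23 h30.
rewrite /keys_of (keyC (code v 3)) (keyC (code v 0) (code v 3)).
by case=> -[->|->] [->|->] /=; rewrite ?h01 ?h12 ?h23 ?h30 eqxx.
Qed.

Lemma refute_palette_sound S : 1 < p -> refute_palette (N.of_nat p) S ->
  (forall d, color_code (C d) \in S) -> ~ nontrivial_coloring C.
Proof.
move=> p1 refS CS /(nontrivial_essential knot_alpha dehnC)[v].
apply/negP; apply: (refute_sound refS) => u /andP[/eqP e02 /eqP e03].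
have code_inj (x y : 'Z_p) : color_code x = color_code y -> x = y.
  by move=> /Nnat.Nat2N.inj /val_inj.
have codeD (x y : 'Z_p) :
    reduce (N.of_nat p) (color_code x + color_code y)%num = color_code (x + y)%R.
  rewrite /color_code /reduce.
  (* The modulus of ['Z_p] is [(Zp_trunc p).+2], which equals [p] because [1 < p]. *)
  have -> : nat_of_ord (x + y)%R = (x + y) %% p by rewrite /= [X in _ %% X](Zp_cast p1).
  have xp : x < p by have := ltn_ord x; rewrite [X in _ < X](Zp_cast p1).
  have yp : y < p by have := ltn_ord y; rewrite [X in _ < X](Zp_cast p1).
  case: N.ltb_spec => xyp; first by rewrite modn_small; lia.
  by rewrite (_ : x + y = (x + y - p) + p); [rewrite modnDr modn_small; lia | lia].
apply: all_crossings_keys; rewrite ?CS //.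
- by rewrite !codeD (corner_eq dehnC) addrC.
- by move=> /code_inj.
by move=> /code_inj.
Qed.

End RefuteSound.

(** * From all small palettes to all colorings, by affine normalization *)

Lemma refute_palettes_sound p cands m S T : refute_palettes p cands m S ->
  uniq T -> {subset T <= cands} -> size T <= m ->
  exists2 S', refute_palette p S' & {subset S ++ T <= S'}.
Proof.
elim: cands m S T => [|c cands IH] m S T.
  case: T => [|t T] refS _ sT _; first by exists S => //; rewrite cats0.
  by have := sT _ (mem_head _ _).
case: m => [|m] /=.
  by move=> refS _ _; rewrite leqn0 size_eq0 => /eqP->; exists S; rewrite ?cats0.
case: ifP => // refS refcS uT sT szT; have [cT|cT] := boolP (c \in T).
  have [t||S' refS' sS'] := IH m (c :: S) (rem c T) refcS (rem_uniq c uT).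
  - by rewrite mem_rem_uniq // !inE => /andP[/negPf tc /sT]; rewrite inE tc.
  - by rewrite size_rem // -subn1 leq_subLR add1n.
  exists S' => // x; rewrite mem_cat => /orP[xS|xT]; apply: sS'.
    by rewrite mem_cat inE xS orbT.
  rewrite mem_cat mem_rem_uniq // !inE xT andbT.
  by case: eqVneq; rewrite ?orbT.
apply: (IH m.+1) => // t tT; have := sT _ tT; rewrite inE => /orP[/eqP tc|//].
by rewrite -tc tT in cT.
Qed.

(** The translation occurs twice on each side of the crossing relation and cancels. *)
Lemma dehn_coloring_affine (p n : nat) (alpha : dart n -> dart n)
    (C : dart n -> 'Z_p) (u a : 'Z_p) :
  dehn_coloring alpha C -> dehn_coloring alpha (fun d => u * (C d - a))%R.
Proof.
move=> [Cface Ccross]; split=> [d|v]; first by rewrite Cface.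
have -> : (u * (C (cdart v 0) - a) + u * (C (cdart v 3) - a) =
  u * ((C (cdart v 0) + C (cdart v 3)) - a - a))%R by ring.
by rewrite Ccross; ring.
Qed.

Lemma num_colors_gt (p k n : nat) (alpha : dart n -> dart n)
    (C : dart n -> 'Z_p) :
  prime p -> refute_small_palettes p k -> is_knot_diagram alpha ->
  dehn_coloring alpha C -> nontrivial_coloring C -> k < num_colors C.
Proof.
move=> p_pr ref knot_alpha dehnC ntC; have p1 := prime_gt1 p_pr.
rewrite ltnNge; apply/negP => leCk.
have [d0 [d1 neC]] : exists d0 d1, C d0 != C d1.
  case: ntC => v ntv.
  have [/existsP[d0 /existsP[d1]] | eqC] := boolP [exists d0, exists d1, C d0 != C d1].
    by exists d0, d1.
  case: ntv; split; apply/eqP; apply: contraNT eqC => ne;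
    apply/existsP; eexists; apply/existsP; eexists; exact: ne.
(* The map [x |-> u * (x - a)] sends [C d0] to 0 and [C d1] to 1; the difference is invertible since
   [p] is prime. *)
pose a := C d0; pose u : 'Z_p := ((C d1 - a)^-1)%R.
have unit_u : (C d1 - a)%R \is a GRing.unit.
  rewrite -[X in X \is a _]natr_Zp unitZpE // prime_coprime // gtnNdvd //.
    rewrite lt0n; apply: contra neC => /eqP e0.
    by rewrite eq_sym -subr_eq0; apply/eqP/val_inj.
  by have := ltn_ord (C d1 - a)%R; rewrite [X in _ < X](Zp_cast p1).
pose C' d : 'Z_p := (u * (C d - a))%R.
have dehnC' : dehn_coloring alpha C' by apply: dehn_coloring_affine.
have C'inj d e : C' d = C' e -> C d = C e.
  by move=> /mulrI -/(_ _) /addIr; apply; rewrite unitrV.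
have ntC' : nontrivial_coloring C'.
  by case: ntC => v ntv; exists v => -[/C'inj ? /C'inj ?]; case: ntv.
pose P : {set 'Z_p} := [set C' d | d : dart n].
have leP : #|P| <= k.
  apply: leq_trans leCk.
  have -> : P = [set (u * (x - a))%R | x in [set C d | d : dart n]].
    by rewrite -imset_comp.
  exact: leq_imset_card.
have P0 : 0%R \in P by apply/imsetP; exists d0; rewrite // /C' subrr mulr0.
have P1 : 1%R \in P by apply/imsetP; exists d1; rewrite // /C' mulVr.
(* The colors other than 0 and 1, at most [k - 2] of them. *)
pose T := [seq color_code x | x <- enum (P :\ 0%R :\ 1%R)].
have [|||S refS sS] := refute_palettes_sound (T := T) ref.
- rewrite map_inj_uniq ?enum_uniq // => x y /Nnat.Nat2N.inj; exact: val_inj.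
- move=> t /mapP[x]; rewrite mem_enum !inE => /and3P[x1 x0 _] ->{t}.
  apply: map_f; rewrite mem_iota subnKC //.
  have -> : x < p by have := ltn_ord x; rewrite [X in _ < X](Zp_cast p1).
  by rewrite andbT; case: x x0 x1 => -[|[]].
- rewrite size_map -cardE; move: leP.
  rewrite (cardsD1 0%R P) P0 (cardsD1 1%R (P :\ 0%R)) !inE P1 andbT.
  by rewrite oner_neq0 /= !add1n => leP;
    rewrite -(leq_add2l 2) subnKC // (leq_trans _ leP).
apply: (refute_palette_sound knot_alpha dehnC' p1 refS _ ntC') => d.
apply: sS; rewrite mem_cat; have [->|C0] := eqVneq (C' d) 0%R.
  by rewrite !inE eqxx orbT.
have [->|C1] := eqVneq (C' d) 1%R; first by rewrite !inE eqxx.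
apply/orP; right; apply: map_f; rewrite mem_enum !inE C0 C1 /=.
exact: imset_f.
Qed.

(** * The computations for 13 and 29, and the bound *)

Lemma refute_small_palettes_13 : refute_small_palettes 13 5.
Proof. by vm_cast_no_check (erefl true). Qed.

Lemma refute_small_palettes_29 : refute_small_palettes 29 6.
Proof. by vm_cast_no_check (erefl true). Qed.

Theorem theorem5p1 (p : nat) :
  (p = 13 \/ p = 29)%N ->
  forall (n : nat) (alpha : 'I_n * 'I_4 -> 'I_n * 'I_4) (C : 'I_n * 'I_4 -> 'Z_p),
    is_knot_diagram alpha ->
    dehn_coloring alpha C ->
    nontrivial_coloring C ->
    (trunc_log 2 p + 3 <= num_colors C)%N.
Proof.
case=> -> n alpha C knot_alpha dehnC ntC.
  (* [trunc_log 2 13 + 3] evaluates to 6, so the goal is [5 < num_colors C]; for 29 it is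
     [6 < num_colors C]. *)
  exact: (num_colors_gt _ refute_small_palettes_13 knot_alpha dehnC ntC).
exact: (num_colors_gt _ refute_small_palettes_29 knot_alpha dehnC ntC).
Qed.
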